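(* Let $N^{-}(s)$ be the number of eigenvalues, counted with multiplicity, in $[-s,0)$ of the operator $L_1=\left(\frac{\partial}{\partial t}\right)^4+\Delta_x$ on $S^1\times S^2$; that is, $$N^{-}(s)=\sum_{\substack{j\in\mathbb{Z},\ k\in\mathbb{Z}_{\ge 0}\\ 0<k(k+1)-j^4\le s}}(2k+1).$$ Then for all sufficiently large $s$, $$\frac{4}{3}s^{3/2}\le N^{-}(s)\le\frac{8}{3}s^{3/2}.$$
   Context: $S^1=\mathbb{R}/2\pi\mathbb{Z}$, $S^2$ is the standard unit sphere, and $\Delta_x$ is the (nonpositive) Laplacian on $S^2$. The eigenfunctions of $L_1$ are $e^{ijt}Y_k(x)$ with $j\in\mathbb{Z}$ and $Y_k$ a spherical harmonic of degree $k\ge 0$; the eigenvalue is $j^4-k(k+1)$, and for each pair $(j,k)$ the corresponding space has dimension $2k+1$. *)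

(* Defs.v *)
From HB Require Import structures.
From mathcomp Require Import all_boot all_order all_algebra.
From mathcomp Require Import all_classical all_reals all_analysis.

Set Implicit Arguments.
Unset Strict Implicit.
Unset Printing Implicit Defensive.

Import Order.TTheory GRing.Theory Num.Theory.

Local Open Scope classical_set_scope.
Local Open Scope ring_scope.

(* Frequencies (j, k) for which the eigenvalue j^4 - k(k+1) of
   L_1 = (d/dt)^4 + Delta_x on S^1 x S^2, attained by the functions
   e^{ijt} Y_k(x) with Y_k a spherical harmonic of degree k, lies in
   [-s, 0). *)
Definition neg_freq (R : realType) (s : R) : set (int * nat) :=
  [set p | 0 < (p.2 * (p.2 + 1))%:R - (p.1%:~R ^+ 4 : R) <= s].

(* Spherical harmonics of degree k form a space of dimension 2k+1. The sum
   is taken in the extended reals so that no finiteness of the index set is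
   presupposed. *)
Definition Nminus (R : realType) (s : R) : \bar R :=
  \esum_(p in neg_freq s) (2 * p.2 + 1)%:R%:E.

(* Main.v *)
Require Import Defs.
From HB Require Import structures.
From mathcomp Require Import all_boot all_order all_algebra.
From mathcomp Require Import all_classical all_reals all_analysis.
From mathcomp Require Import zify lra.

Set Implicit Arguments.
Unset Strict Implicit.
Unset Printing Implicit Defensive.

Import Order.TTheory GRing.Theory Num.Theory.

Local Open Scope classical_set_scope.
Local Open Scope ring_scope.

(** Write t = sqrt s and, for a fixed frequency j, a = |j|. The sum of 2k+1
    over an interval of degrees telescopes to a difference of squares, so the
    degrees k with a^4 < k(k+1) <= a^4 + s contribute (K+1)^2 - a^4 when a > 0,
    where K is the largest k with k(k+1) <= a^4 + s. Since k = a^2 is the first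
    admissible degree, the contribution vanishes once a > t.

    As (K+1)^2 differs from a^4 + s by at most K + 1 <= a^2 + t + 1, the
    contribution lies between s - a^2 and s + a^2 up to O(t). Summed over
    0 < |j| <= t this yields (2 -+ 2/3) t^3 + O(t^2): exactly the constants
    4/3 and 8/3, but with an error term that would spoil them. Room is gained
    where a is close to t: as soon as 3a^2 + 2 > s the only admissible degree
    is k = a^2, so the contribution is exactly 2a^2 + 1, and for most such a
    this lies well inside the crude interval. Using it for 2t/3 < a <= t moves
    the leading constants to 56/27 > 4/3 and 200/81 < 8/3, and the O(t^2) error
    is then absorbed for large t.

    All counting is done in natural numbers, with n = floor s and J = floor t:
    column_bounds treats a single frequency, lattice_count_bounds sums these
    estimates into 4 (J+1)^3 <= 3 N <= 8 J^3, and NminusE identifies N with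
    the sum over the frequency set. Since J <= t < J+1, the cubic bounds for J
    give those for t. *)

(** * Counting the degrees that belong to one frequency *)

Local Open Scope nat_scope.

Definition oblong_root (M : nat) : nat :=
  \max_(k < M.+1 | k * (k + 1) <= M) k.

Lemma leq_oblong_root k M : (k <= oblong_root M) = (k * (k + 1) <= M).
Proof.
apply/idP/idP => [kM|kM].
- have : oblong_root M * (oblong_root M + 1) <= M.
    rewrite /oblong_root; apply: (big_ind (fun r => r * (r + 1) <= M)) => //.
    by move=> x y xM yM; case: (leqP x y).
  by apply: leq_trans; apply: leq_mul => //; rewrite leq_add2r.
- have kM1 : k < M.+1 by nia.
  exact: (leq_bigmax_cond (Ordinal kM1)).
Qed.

(** With b = a^2, the square b * b falls between the consecutive oblong numbers
    (b - 1) * b and b * (b + 1); this is why the degrees with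
    k (k + 1) > a^4 start at k = a^2. *)
Lemma oblong_root_quartic a : 0 < a -> (oblong_root (a ^ 4)).+1 = a ^ 2.
Proof.
move=> a0; have a4 : a ^ 4 = a ^ 2 * a ^ 2 by rewrite -expnD.
have b0 : 0 < a ^ 2 by rewrite expn_gt0 a0.
move: (a ^ 2) b0 a4 => b b0 ->.
apply/eqP; rewrite eqn_leq ltnNge !leq_oblong_root -(prednK b0) ltnS leq_oblong_root.
by apply/andP; split; nia.
Qed.

Lemma sum_mult m n : m <= n -> \sum_(m <= k < n) (2 * k + 1) + m ^ 2 = n ^ 2.
Proof.
elim: n => [|n IHn]; first by rewrite leqn0 => /eqP ->; rewrite big_geq.
rewrite leq_eqVlt => /predU1P[->|]; first by rewrite big_geq.
by rewrite ltnS => mn; rewrite big_nat_recr //= addnAC IHn //; nia.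
Qed.

Lemma sum_squares n : 6 * \sum_(1 <= a < n.+1) a ^ 2 = n * (n + 1) * (2 * n + 1).
Proof.
elim: n => [|n IHn]; first by rewrite big_geq.
by rewrite big_nat_recr //= mulnDr IHn; nia.
Qed.

(** Total multiplicity of the eigenvalues in [-n, 0) coming from one time
    frequency of absolute value a. *)
Definition column (n a : nat) : nat :=
  \sum_((oblong_root (a ^ 4)).+1 <= k < (oblong_root (a ^ 4 + n)).+1)
    (2 * k + 1).

(** With b = a^2 and K the last admissible degree, b <= K <= b + J, and
    (K + 1)^2 - b^2 is pinned by K (K + 1) <= b^2 + n < (K + 1) (K + 2). The
    degree k = b alone contributes 2b + 1, and k = b + 1 is admissible only if
    3b + 2 <= n. *)
Lemma column_bounds n J a : 0 < a -> a ^ 2 <= n -> n < J.+1 ^ 2 ->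
  [/\ column n a <= n + J.+1 + a ^ 2,
      n <= column n a + J + a ^ 2 &
      n < 3 * a ^ 2 + 2 -> column n a = (2 * a ^ 2).+1].
Proof.
move=> a0 an nJ; rewrite /column oblong_root_quartic //.
have b0 : 0 < a ^ 2 by rewrite expn_gt0 a0.
have a4 : a ^ 4 = a ^ 2 * a ^ 2 by rewrite -expnD.
rewrite a4; move: (a ^ 2) b0 an => b b0 bn {a4}.
set K := oblong_root _.
have bK : b <= K by rewrite leq_oblong_root; nia.
have KJ : K <= b + J by rewrite leqNgt leq_oblong_root; nia.
have Kle : K * (K + 1) <= b * b + n by rewrite -leq_oblong_root.
have Klt : b * b + n < K.+1 * (K.+1 + 1) by rewrite ltnNge -leq_oblong_root ltnn.
have := sum_mult (leqW bK); set S := \sum_(_ <= _ < _) _ => SE.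
have {}SE : S + b * b = K * (K + 1) + K + 1 by nia.
split; [nia|nia|].
move=> n3; have KE : K = b; last by nia.
by apply/eqP; rewrite eqn_leq bK andbT leqNgt leq_oblong_root; nia.
Qed.

Lemma column0_bound n J : n < J.+1 ^ 2 -> column n 0 <= J.+1 ^ 2.
Proof.
move=> nJ; rewrite /column exp0n // add0n.
have KJ : oblong_root n <= J by rewrite leqNgt leq_oblong_root; nia.
have K0 : oblong_root 0 = 0.
  by apply/eqP; rewrite -leqn0 leqNgt leq_oblong_root.
rewrite K0; have := @sum_mult 1 (oblong_root n).+1 isT.
have : (oblong_root n).+1 ^ 2 <= J.+1 ^ 2 by rewrite leq_exp2r.
by move: (\sum_(_ <= _ < _) _) => S; lia.
Qed.

(** * Summing over the frequencies *)

(** The frequencies j and -j contribute equally, hence the factor 2. *)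
Definition lattice_count n J := column n 0 + 2 * \sum_(1 <= a < J.+1) column n a.

(** The sum is cut at A, about 2J/3: up to A the crude estimates of
    column_bounds are used, above A the exact value 2a^2 + 1. The leading terms
    are then 56/27 J^3 and 200/81 J^3, against the required 4/3 and 8/3, and
    J >= 300 suffices to absorb the quadratic terms. *)
Lemma lattice_count_bounds n J : 300 <= J -> J ^ 2 <= n -> n < J.+1 ^ 2 ->
  4 * J.+1 ^ 3 <= 3 * lattice_count n J <= 8 * J ^ 3.
Proof.
move=> J300 Jn nJ.
pose q := J %/ 3; pose A := 2 * q.
have qJ : 3 * q <= J <= 3 * q + 2 by rewrite /q; lia.
have AJ : A < J.+1 by rewrite /A; lia.
have sq a : a < J.+1 -> a ^ 2 <= n.
  by rewrite ltnS => aJ; apply: leq_trans Jn; rewrite leq_exp2r.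
have split F : \sum_(1 <= a < J.+1) F a =
    \sum_(1 <= a < A.+1) F a + \sum_(A.+1 <= a < J.+1) F a.
  by rewrite (@big_cat_nat _ _ _ A.+1).
have SJ := sum_squares J; have SA := sum_squares A.
have Ssplit := split (fun a => a ^ 2).
have low : \sum_(1 <= a < A.+1) column n a <=
           A * (n + J.+1) + \sum_(1 <= a < A.+1) a ^ 2.
  rewrite -{2}[A]subn0 -subSS -sum_nat_const_nat -big_split /=.
  rewrite big_nat [leqRHS]big_nat; apply: leq_sum => a /andP[a0 aA].
  by have [] := column_bounds a0 (sq a (leq_trans aA AJ)) nJ.
have low' : A * n <=
    \sum_(1 <= a < A.+1) column n a + A * J + \sum_(1 <= a < A.+1) a ^ 2.
  rewrite -{1 3}[A]subn0 -subSS -!sum_nat_const_nat -!big_split /=.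
  rewrite big_nat [leqRHS]big_nat; apply: leq_sum => a /andP[a0 aA].
  by have [] := column_bounds a0 (sq a (leq_trans aA AJ)) nJ.
have high : \sum_(A.+1 <= a < J.+1) column n a =
            2 * (\sum_(A.+1 <= a < J.+1) a ^ 2) + (J - A).
  rewrite big_distrr /= -[J - A]muln1 -subSS -sum_nat_const_nat -big_split /=.
  apply: eq_big_nat => a /andP[Aa aJ]; rewrite addn1.
  have [|_ _] := column_bounds _ (sq a aJ) nJ; first exact: leq_ltn_trans Aa.
  apply; have : (2 * q).+1 ^ 2 <= a ^ 2 by rewrite leq_exp2r.
  have nq : n < (3 * q + 3) ^ 2.
    by apply: leq_trans nJ _; rewrite leq_exp2r //; lia.
  have q2 : 100 * q <= q * q by rewrite leq_mul2r; apply/orP; right; lia.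
  move: (a ^ 2) => b {low low' SJ SA Ssplit split sq}; lia.
have := column0_bound nJ.
rewrite /lattice_count split.
move: low low' high SJ SA Ssplit.
set C0 := column n 0; set C1 := \sum_(_ <= _ < A.+1) _.
set C2 := \sum_(_ <= _ < J.+1) _.
set SA := \sum_(1 <= _ < A.+1) _ ^ _.
set SJ := \sum_(1 <= _ < J.+1) _ ^ _.
set SH := \sum_(A.+1 <= _ < J.+1) _ ^ _.
move=> low low' high ESJ ESA ES C0J.
have An : A * J ^ 2 <= A * n by rewrite leq_mul2l Jn orbT.
have An' : A * n <= A * (J ^ 2 + 2 * J) by rewrite leq_mul2l; apply/orP; right; nia.
move: C0 C1 C2 SA SJ SH low low' high ESJ ESA ES C0J An An' => C0 C1 C2 SA SJ SH.
(* Writing q = p + 100, each goal becomes an inequality between polynomials in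
   p whose difference has nonnegative coefficients, for each J mod 3. *)
have [p pE] : exists p, q = p + 100 by exists (q - 100); lia.
rewrite /A pE.
have p2 : 0 <= p * p by [].
have p3 : 0 <= p * p * p by [].
have : [|| J == 3 * q, J == 3 * q + 1 | J == 3 * q + 2] by lia.
rewrite pE => /or3P[] /eqP -> *; apply/andP; split; lia.
Qed.
Local Close Scope nat_scope.

(** * From the frequency set to the natural-number count *)

(** Negz a is - (a + 1), so this enumerates the interval [-J, J]. *)
Definition freq_range (J : nat) : seq int :=
  map Posz (iota 0 J.+1) ++ map Negz (iota 0 J).

Lemma mem_freq_range J (j : int) : (j \in freq_range J) = (`|j| <= J)%N.
Proof.
rewrite mem_cat; case: j => a.
- rewrite mem_map; last by move=> x y [].
  rewrite mem_iota /= add0n ltnS orb_idr //.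
  by case/mapP.
- rewrite orbC mem_map; last by move=> x y [].
  rewrite mem_iota /= add0n orb_idr //.
  by case/mapP.
Qed.

Lemma uniq_freq_range J : uniq (freq_range J).
Proof.
rewrite cat_uniq !map_inj_uniq ?iota_uniq /=; try by move=> x y [].
by rewrite andbT; apply/hasPn => _ /mapP[a _ ->]; apply/negP => /mapP[].
Qed.

Lemma sum_freq_range J (F : nat -> nat) :
  (\sum_(j <- freq_range J) F `|j| = F 0 + 2 * \sum_(1 <= a < J.+1) F a)%N.
Proof.
rewrite big_cat !big_map /= big_cons mul2n -addnn -addnA; congr (_ + (_ + _))%N.
  by rewrite /index_iota subSS subn0.
by rewrite /index_iota subSS subn0 (iotaDl 1 0) big_map.
Qed.

Definition neg_freq_seq (n J : nat) : seq (int * nat) :=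
  [seq (j, k) | j <- freq_range J,
                k <- index_iota (oblong_root (`|j| ^ 4)).+1
                                (oblong_root (`|j| ^ 4 + n)).+1].

Lemma uniq_neg_freq_seq n J : uniq (neg_freq_seq n J).
Proof.
apply: allpairs_uniq_dep => [|j _|]; first exact: uniq_freq_range.
  exact: iota_uniq.
by move=> [j k] [j' k'] _ _ /= [-> ->].
Qed.

(** The eigenvalues are integers, so only n = floor s matters. A frequency
    beyond J contributes no degree, because the first candidate k = j^2 already
    has k (k + 1) - j^4 = j^2 > n. *)
Lemma neg_freqE (R : realType) (s : R) (n J : nat) :
  n%:R <= s < n.+1%:R -> (n < J.+1 ^ 2)%N ->
  neg_freq s = [set` neg_freq_seq n J].
Proof.
move=> /andP[ns sn] nJ.
have key (a k : nat) : (0 < (k * (k + 1))%:R - (a%:R ^+ 4 : R) <= s) =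
    (oblong_root (a ^ 4) < k <= oblong_root (a ^ 4 + n))%N.
  rewrite -natrX subr_gt0 ltr_nat.
  rewrite [(oblong_root _ < k)%N]ltnNge !leq_oblong_root -ltnNge.
  case: ltnP => //= ak; rewrite -natrB ?(ltnW ak)// -leq_subLR.
  apply/idP/idP => [le_s|le_n].
    by rewrite -ltnS -(ltr_nat R) (le_lt_trans le_s).
  by rewrite (le_trans _ ns)// ler_nat.
have abs4 (j : int) : (j%:~R ^+ 4 : R) = `|j|%N%:R ^+ 4.
  by case: j => a //; rewrite NegzE mulrNz (exprM _ 2 2) sqrrN -exprM.
apply/seteqP; split => [[j k]|[j k]].
- rewrite /neg_freq /= abs4 key => jk.
  apply/allpairsPdep; exists j, k; rewrite mem_index_iota ltnS jk mem_freq_range.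
  split=> //; case/andP: jk => lo hi.
  case: (posnP `|j|) => [->//|j0].
  move: lo; rewrite oblong_root_quartic // => lo.
  have : (`|j| ^ 2 * (`|j| ^ 2 + 1) <= `|j| ^ 4 + n)%N.
    by rewrite -leq_oblong_root (leq_trans lo).
  nia.
- rewrite /neg_freq /= => /allpairsPdep[j' [k' [_ jk' [-> ->]]]].
  by move: jk'; rewrite abs4 key mem_index_iota.
Qed.

Lemma NminusE (R : realType) (s : R) (n J : nat) :
  n%:R <= s < n.+1%:R -> (n < J.+1 ^ 2)%N ->
  Nminus s = (lattice_count n J)%:R%:E.
Proof.
move=> ns nJ; rewrite /Nminus (neg_freqE ns nJ) esum_fset; last 2 first.
- exact: finite_seq.
- by move=> p _; rewrite lee_fin.
rewrite -fsbig_seq ?uniq_neg_freq_seq// sumEFin -natr_sum big_allpairs_dep /=.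
by rewrite (sum_freq_range J (column n)).
Qed.

Lemma Nminus_sqr_bounds (R : realType) (t : R) : 300%N%:R <= t ->
  ((4 / 3 * t ^+ 3)%:E <= Nminus (t ^+ 2))%E /\
  (Nminus (t ^+ 2) <= (8 / 3 * t ^+ 3)%:E)%E.
Proof.
move=> t_ge; have t0 : 0 <= t by apply: le_trans t_ge; exact: ler0n.
have [n ns] : exists n, n%:R <= t ^+ 2 < n.+1%:R.
  by exists (Num.truncn (t ^+ 2)); apply: truncn_itv; exact: exprn_ge0.
have [J /andP[Jt tJ]] : exists J, J%:R <= t < J.+1%:R.
  by exists (Num.truncn t); exact: truncn_itv.
have J300 : (300 <= J)%N by rewrite -ltnS -(ltr_nat R) (le_lt_trans t_ge).
have t3lo : t ^+ 3 <= J.+1%:R ^+ 3 by rewrite lerXn2r ?nnegrE ?ler0n// ltW.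
have t3hi : J%:R ^+ 3 <= t ^+ 3 by rewrite lerXn2r ?nnegrE ?ler0n.
have [ns1 ns2] := andP ns.
have Jn : (J ^ 2 <= n)%N.
  rewrite -ltnS -(ltr_nat R) natrX; apply: le_lt_trans ns2.
  by rewrite lerXn2r ?nnegrE ?ler0n.
have nJ : (n < J.+1 ^ 2)%N.
  rewrite -(ltr_nat R) natrX; apply: (le_lt_trans ns1).
  by rewrite ltrXn2r ?nnegrE ?ler0n.
have /andP[lo hi] := lattice_count_bounds J300 Jn nJ.
rewrite (NminusE ns nJ) !lee_fin.
move: lo hi; rewrite -!(ler_nat R) !(natrX, natrM).
move: (lattice_count n J)%:R (t ^+ 3) (J%:R ^+ 3) (J.+1%:R ^+ 3) t3lo t3hi.
by move=> N x y z x_le z_le lo hi {t_ge J300}; lra.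
Qed.

Theorem theorem6p4 (R : realType) :
  \forall s \near +oo%R,
    ((4 / 3 * s `^ (3 / 2) : R)%:E <= Nminus s)%E /\
    (Nminus s <= (8 / 3 * s `^ (3 / 2) : R)%:E)%E.
Proof.
near=> s.
have s_ge : 300%N%:R ^+ 2 <= s.
  by near: s; apply: nbhs_pinfty_ge; rewrite num_real.
have s0 : 0 <= s by apply: le_trans s_ge; exact: sqr_ge0.
have -> : s `^ (3 / 2) = Num.sqrt s ^+ 3.
  by rewrite mulrC powRrM powR12_sqrt// powR_mulrn// sqrtr_ge0.
rewrite -{2 3}(sqr_sqrtr s0); apply: Nminus_sqr_bounds.
by rewrite -(@ler_pXn2r _ 2) ?nnegrE ?ler0n ?sqrtr_ge0// sqr_sqrtr.
Unshelve. all: by end_near.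
Qed.
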